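(* Let $L$ be a finite lattice, let $\varphi$ be a capacity on $L$ and $\psi$ a completely monotone capacity on $L$. Suppose that $$\Lambda_{a_1,\ldots,a_k}\varphi(\hat1)\le\nabla_{a_1,\ldots,a_k}\psi(\hat1)\quad\text{for every monotone path }(a_1,\dots,a_k)\text{ in }L.$$ Then there exist an $\mathcal L$-valued random variable $\mathcal X$ and an $L$-valued random variable $Y$ on a common probability space with $\mathbb P(x\in\mathcal X)=\varphi(x)$ and $\mathbb P(Y\le x)=\psi(x)$ for all $x\in L$, and $\mathbb P(Y\in\mathcal X)=1$.
   Context: $L$ is a finite lattice with minimum $\hat0$, maximum $\hat1$, meet $\wedge$, join $\vee$. A capacity is a monotone $\varphi$ with $\varphi(\hat0)=0$, $\varphi(\hat1)=1$. $\nabla_a\varphi(x)=\varphi(x)-\varphi(x\wedge a)$, $\nabla_{a_1,\ldots,a_k}\varphi=\nabla_{a_k}(\nabla_{a_1,\ldots,a_{k-1}}\varphi)$; completely monotone means all these are nonnegative. $\mathcal L$ is the set of nonempty up-sets of $L$. A path from $a$ to $b$ is a sequence $H=(h_0,\dots,h_m)$ of distinct elements of $L$ with $h_0=a$, $h_m=b$; $\varphi(H)=\sum_{i=0}^m\varphi(h_i)-\sum_{i=1}^m\varphi(h_{i-1}\vee h_i)$; $\lambda(\varphi;a,b)=\max\{\varphi(H): H\text{ a path from }a\text{ to }b\}$; $\Lambda_a\varphi(x)=\varphi(x)-\lambda(\varphi;a,x)$ and $\Lambda_{a_1,\ldots,a_k}\varphi=\Lambda_{a_k}(\Lambda_{a_1,\ldots,a_{k-1}}\varphi)$.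 A monotone path is a sequence $(a_1,\dots,a_k)$, $k\ge1$, of distinct elements of $L$ such that $i<j$ whenever $a_i<a_j$. *)

(* Defs.v *)
From HB Require Import structures.
From mathcomp Require Import all_boot all_order all_algebra.
Set Implicit Arguments. Unset Strict Implicit. Unset Printing Implicit Defensive.
Import Order.TTheory GRing.Theory Num.Theory.

Local Open Scope order_scope.

Section Defs.
Context {d : Order.disp_t} {L : finTBLatticeType d} {R : realFieldType}.

Definition capacity (phi : L -> R) : Prop :=
  [/\ (forall x y : L, x <= y -> (phi x <= phi y)%R),
      phi \bot = 0%R & phi \top = 1%R].

Definition nabla (a : L) (phi : L -> R) : L -> R :=
  fun x => (phi x - phi (x `&` a))%R.

Definition nablas (s : seq L) (phi : L -> R) : L -> R :=
  foldl (fun f a => nabla a f) phi s.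

Definition completely_monotone (phi : L -> R) : Prop :=
  forall (s : seq L) (x : L), (0 <= nablas s phi x)%R.

Definition is_path_from_to (a b : L) (t : seq L) : bool :=
  uniq (a :: t) && (last a t == b).

Definition path_value (phi : L -> R) (a : L) (t : seq L) : R :=
  (\sum_(h <- a :: t) phi h - \sum_(p <- zip (a :: t) t) phi (p.1 `|` p.2))%R.

(* lambda(phi; a, b): maximum of phi(H) over paths H from a to b.
   Paths have at most #|L| elements, so t ranges over n-tuples with n < #|L|.
   The default value of the max is the value of the path (a) or (a, b),
   which is itself a path from a to b. *)
Definition lambda (phi : L -> R) (a b : L) : R :=
  \big[Num.max/path_value phi a (if a == b then [::] else [:: b])]_(n < #|L|)
    \big[Num.max/path_value phi a (if a == b then [::] else [:: b])]_(t : n.-tuple L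
          | is_path_from_to a b t) path_value phi a t.

Definition Lam (a : L) (phi : L -> R) : L -> R :=
  fun x => (phi x - lambda phi a x)%R.

Definition Lams (s : seq L) (phi : L -> R) : L -> R :=
  foldl (fun f a => Lam a f) phi s.

Definition monotone_path (s : seq L) : Prop :=
  [/\ s != [::], uniq s &
      forall i j : nat, (i < size s)%N -> (j < size s)%N ->
        nth \bot s i < nth \bot s j -> (i < j)%N].

Definition nonempty_upset (X : {set L}) : Prop :=
  X != set0 /\ forall x y : L, x \in X -> x <= y -> y \in X.

End Defs.

(* Main.v *)
Require Import Defs.
From HB Require Import structures.
From mathcomp Require Import all_boot all_order all_algebra.
From mathcomp Require Import boolp reals.
From mathcomp Require Import ring lra.
Import Order.TTheory GRing.Theory Num.Theory.

(* Write psi(x) = sum_(y <= x) g(y) with g >= 0.  By Farkas' lemma the coupling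
   exists as soon as sum u phi + sum v g <= 0 whenever u(X) + v(y) <= 0 for
   all up-sets X and all y in X.  Replacing v by V(y) = max_(z >= y) v(z), one
   may take v antitone; list L as a_1, ..., a_n with V decreasing, breaking ties
   by a linear extension, so that every prefix is a monotone path.  The greedy
   recursion splits phi into f_1 + ... + f_n, where f_k is lambda at a_k of
   Lambda_(a_1, ..., a_(k-1)) phi: each f_k is monotone with
   f_k(a_k) = f_k(top), so it is a mixture of up-sets containing a_k and
   sum u f_k <= - V(a_k) f_k(top).  The hypothesis says that the partial sums of
   the masses f_k(top) dominate those of g(a_k), and Abel summation concludes. *)

Local Open Scope ring_scope.

(** * Farkas' lemma for finitely many linear forms *)

Lemma farkas (R : realFieldType) (J : finType) (T : eqType) (s : seq T)
    (A : T -> J -> R) (c : J -> R) :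
  uniq s ->
  (forall x : J -> R, (forall t, t \in s -> \sum_j A t j * x j <= 0) ->
     \sum_j c j * x j <= 0) ->
  exists l : T -> R, (forall t, 0 <= l t) /\
    forall j, c j = \sum_(t <- s) l t * A t j.
Proof.
elim: s A c => [|t0 s IHs] A c /=.
  move=> _ c_le0; exists (fun=> 0); split=> // j; rewrite big_nil.
  (* With no constraints left, testing at [c j] times the [j]-th unit vector gives
     [c j ^+ 2 <= 0]. *)
  have := c_le0 (fun i => c i *+ (i == j)) (fun t => ltac:(by [])).
  rewrite (bigD1 j) //= eqxx mulr1n big1 ?addr0 => [|i /negbTE->]; last by rewrite mulr0.
  by rewrite -expr2 => cj2; apply/eqP; rewrite -sqrf_eq0 eq_le cj2 sqr_ge0.
case/andP=> t0s uniq_s c_le0.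
have [c_le0'|] := pselect (forall x : J -> R,
    (forall t, t \in s -> \sum_j A t j * x j <= 0) -> \sum_j c j * x j <= 0).
  have [l [l_ge0 c_l]] := IHs A c uniq_s c_le0'.
  exists (fun t => if t == t0 then 0 else l t); split=> [t|j]; first by case: ifP.
  rewrite big_cons eqxx mul0r add0r c_l.
  by apply: eq_big_seq => t ts; case: eqP => // tt0; rewrite -tt0 ts in t0s.
case/existsNP=> x0 /not_implyP [Ax0 /negP]; rewrite -ltNge => cx0.
(* If [t0] cannot be dropped, the witness [x0] meets every constraint of [s] but not the conclusion,
   so it must violate the constraint [t0]. *)
have a0_gt0 : 0 < \sum_j A t0 j * x0 j.
  rewrite ltNge; apply/negP => a0; move: cx0; rewrite ltNge c_le0 // => t.
  by rewrite inE => /predU1P[->|/Ax0].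
set k := \sum_j A t0 j * x0 j in a0_gt0.
pose dot (B : J -> R) := \sum_j B j * x0 j.
(* [prj B] is [B] composed with the projection along [x0] onto the kernel of [A t0]. Projected
   points satisfy the constraint [t0] with equality, so the induction hypothesis applies to the
   projected forms. *)
pose prj (B : J -> R) j := B j - dot B / k * A t0 j.
have prjE (B : J -> R) x :
    \sum_j prj B j * x j =
    \sum_j B j * (x j - (\sum_i A t0 i * x i) / k * x0 j).
  transitivity (\sum_j B j * x j - dot B / k * \sum_i A t0 i * x i).
    rewrite mulr_sumr -sumrB; apply: eq_bigr => j _; rewrite /prj; ring.
  rewrite /dot.
  rewrite [_ / k * _](_ : _ = (\sum_j B j * x0 j) * ((\sum_i A t0 i * x i) / k));
    last by ring.
  rewrite mulr_suml -sumrB; apply: eq_bigr => j _; ring.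
have [|l [l_ge0 c_l]] := IHs (fun t => prj (A t)) (prj c) uniq_s.
  move=> x Ax; rewrite prjE; apply: c_le0 => t; rewrite inE => /predU1P[->|ts].
    rewrite -prjE big1 // => j _; rewrite /prj /dot -/k divff ?gt_eqF //.
    by rewrite mul1r subrr mul0r.
  by rewrite -prjE Ax.
(* Undoing the projection forces this coefficient of [A t0]; it is nonnegative since [dot c > 0] and
   [dot (A t) <= 0] on [s]. *)
pose l0 := (dot c - \sum_(t <- s) l t * dot (A t)) / k.
exists (fun t => if t == t0 then l0 else l t); split=> [t|j].
  case: ifP => // _; rewrite /l0 divr_ge0 ?(ltW a0_gt0) // subr_ge0.
  apply: le_trans (ltW cx0); rewrite big_seq sumr_le0 // => i i_s.
  by rewrite mulr_ge0_le0 ?Ax0.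
rewrite big_cons eqxx; have := c_l j; rewrite /prj => /eqP; rewrite subr_eq => /eqP->.
rewrite addrC [X in _ = _ + X](eq_big_seq
  (fun t => l t * prj (A t) j + l t * dot (A t) * (A t0 j / k))).
  by rewrite big_split /= -[X in _ + (_ + X)]mulr_suml /prj /l0; ring.
move=> t ts; case: eqP => [tt0|_]; first by rewrite -tt0 ts in t0s.
by rewrite /prj; ring.
Qed.

Section FiniteLattice.
Variables (d : Order.disp_t) (L : finTBLatticeType d) (R : realFieldType).
Implicit Types (phi psi f u : L -> R) (a x y : L).

Definition monotone phi := forall x y, (x <= y)%O -> phi x <= phi y.

Definition upset (X : {set L}) :=
  [forall x, forall y, (x \in X) ==> (x <= y)%O ==> (y \in X)].

Lemma upsetP (X : {set L}) :
  reflect (forall x y, x \in X -> (x <= y)%O -> y \in X) (upset X).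
Proof.
apply: (iffP forallP) => [XP x y xX xy|XP x].
  by have /forallP/(_ y)/implyP/(_ xX)/implyP/(_ xy) := XP x.
by apply/forallP=> y; apply/implyP=> xX; apply/implyP; apply: XP.
Qed.

(** * The function [lambda phi a] *)

Lemma path_value_nil phi a : path_value phi a [::] = phi a.
Proof. by rewrite /path_value big_seq1 big_nil subr0. Qed.

Lemma path_value_cons phi a b t :
  path_value phi a (b :: t) = phi a - phi (a `|` b)%O + path_value phi b t.
Proof. by rewrite /path_value /= !big_cons /=; ring. Qed.

Lemma path_value_cat phi a t1 t2 :
  path_value phi a (t1 ++ t2) =
  path_value phi a t1 - phi (last a t1) + path_value phi (last a t1) t2.
Proof.
elim: t1 a => [|b t IHt] a /=; first by rewrite path_value_nil subrr add0r.
by rewrite !path_value_cons IHt; ring.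
Qed.

(** Charge each join to the vertex preceding it, which it dominates: only the last vertex remains.
    Charging to the following vertex gives the next bound. *)
Lemma path_value_le_last phi a t :
  monotone phi -> path_value phi a t <= phi (last a t).
Proof.
move=> phi_mono; elim: t a => [|b t IHt] a /=; first by rewrite path_value_nil.
have := IHt b; have := phi_mono _ _ (leUl a b).
by rewrite path_value_cons; lra.
Qed.

Lemma path_value_le_head phi a t : monotone phi -> path_value phi a t <= phi a.
Proof.
move=> phi_mono; elim: t a => [|b t IHt] a /=; first by rewrite path_value_nil.
have := IHt b; have := phi_mono _ _ (leUr b a).
by rewrite path_value_cons; lra.
Qed.

Lemma path_value_le_lambda phi a b t :
  is_path_from_to a b t -> path_value phi a t <= lambda phi a b.
Proof.
move=> ab_t; have size_t : (size t < #|L|)%N.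
  by case/andP: ab_t => /card_uniqP/= <- _; apply: max_card.
rewrite /lambda; apply: (le_trans _ (le_bigmax_cond _ _ (j := Ordinal size_t) _)) => //=.
exact: (le_bigmax_cond _ _ (j := in_tuple t)).
Qed.

Lemma lambda_path phi a b :
  exists2 t, is_path_from_to a b t & lambda phi a b = path_value phi a t.
Proof.
set Q := fun v : R => exists2 t, is_path_from_to a b t & v = path_value phi a t.
have Q0 : Q (path_value phi a (if a == b then [::] else [:: b])).
  exists (if a == b then [::] else [:: b]) => //; rewrite /is_path_from_to.
  by case: (eqVneq a b) => [->|ab]; rewrite /= ?inE ?ab eqxx.
have Qmax v w : Q v -> Q w -> Q (Num.max v w) by move=> Qv Qw; case: leP.
rewrite -/(Q _); apply: (big_ind Q) => // n _; apply: (big_ind Q) => // t ab_t.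
by exists t.
Qed.

(* A walk that revisits a vertex may be cut short: every step contributes a
   nonpositive amount. *)
Lemma lambda_bellman phi a x y : monotone phi ->
  lambda phi a y + phi x - phi (x `|` y)%O <= lambda phi a x.
Proof.
move=> phi_mono; have [t /andP[uniq_t /eqP last_t] ->] := lambda_path phi a y.
have [xt|xt] := boolP (x \in a :: t).
  case/splitPl: xt uniq_t last_t => t1 t2 last_t1 uniq_t last_t.
  have ax_t1 : is_path_from_to a x t1.
    rewrite /is_path_from_to last_t1 eqxx andbT.
    by move: uniq_t; rewrite -cat_cons cat_uniq => /andP[].
  have := path_value_le_lambda phi _ _ _ ax_t1.
  have := path_value_le_head phi x t2 phi_mono.
  have := phi_mono _ _ (leUl x y).
  by rewrite path_value_cat last_t1; lra.
have ax_t : is_path_from_to a x (t ++ [:: x]).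
  by rewrite /is_path_from_to last_cat eqxx andbT cats1 -rcons_cons rcons_uniq xt.
have := path_value_le_lambda phi _ _ _ ax_t.
rewrite path_value_cat last_t path_value_cons path_value_nil joinC; lra.
Qed.

(** On a comparable pair the join in [lambda_bellman] is the larger element: a step up costs
    nothing, which is used here, and a step down from [y] to [x] loses at most [phi y - phi x],
    which gives [monotone_Lam]. *)
Lemma monotone_lambda phi a : monotone phi -> monotone (lambda phi a).
Proof.
move=> phi_mono x y xy; have := lambda_bellman phi a y x phi_mono.
by rewrite (join_l xy); lra.
Qed.

Lemma monotone_Lam phi a : monotone phi -> monotone (Lam a phi).
Proof.
move=> phi_mono x y xy; have := lambda_bellman phi a x y phi_mono.
by rewrite /Lam (join_r xy); lra.
Qed.

Lemma lambda_le phi a x : monotone phi -> lambda phi a x <= phi x.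
Proof.
move=> phi_mono; have [t /andP[_ /eqP <-] ->] := lambda_path phi a x.
exact: path_value_le_last.
Qed.

Lemma lambda_le_base phi a x : monotone phi -> lambda phi a x <= phi a.
Proof.
move=> phi_mono; have [t _ ->] := lambda_path phi a x.
exact: path_value_le_head.
Qed.

Lemma lambda_base phi a : monotone phi -> lambda phi a a = phi a.
Proof.
move=> phi_mono; apply: le_anti; rewrite lambda_le //= -[leLHS]path_value_nil.
by apply: path_value_le_lambda; rewrite /is_path_from_to /= eqxx.
Qed.

Lemma lambda_top phi a : monotone phi -> lambda phi a \top%O = phi a.
Proof.
move=> phi_mono; apply: le_anti; rewrite lambda_le_base //= -(lambda_base phi a phi_mono).
by apply: monotone_lambda; rewrite ?lex1.
Qed.

Lemma lambda_ge0 phi a x : monotone phi -> 0 <= phi \bot%O -> 0 <= lambda phi a x.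
Proof.
move=> phi_mono phi0; apply: le_trans (monotone_lambda phi a phi_mono _ _ (le0x x)).
(* The step from [a] down to the bottom has join [a], so it leaves the value [phi \bot]. *)
have := lambda_bellman phi a \bot%O a phi_mono.
by rewrite join0x lambda_base //; lra.
Qed.

Lemma Lams_rcons (s : seq L) a phi : Lams (rcons s a) phi = Lam a (Lams s phi).
Proof. by rewrite /Lams foldl_rcons. Qed.

Lemma Lams_monotone (s : seq L) phi : monotone phi -> 0 <= phi \bot%O ->
  monotone (Lams s phi) /\ 0 <= Lams s phi \bot%O.
Proof.
move=> phi_mono phi0; elim/last_ind: s => [|s a [IHm IH0]] //.
rewrite Lams_rcons; split; first exact: monotone_Lam.
by rewrite subr_ge0 lambda_le.
Qed.

(** Peeling at [a] removes the whole value there, and later peelings can neither raise it nor make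
    it negative. Once [s] lists all of [L], nothing of [phi] remains. *)
Lemma Lams_mem (s : seq L) phi a : monotone phi -> 0 <= phi \bot%O ->
  a \in s -> Lams s phi a = 0.
Proof.
move=> phi_mono phi0; elim/last_ind: s => [|s b IHs] // as_; apply: le_anti.
have [s_mono s_ge0] := Lams_monotone s phi phi_mono phi0.
have [sb_mono sb_ge0] := Lams_monotone (rcons s b) phi phi_mono phi0.
rewrite (le_trans sb_ge0) ?andbT; last by apply: sb_mono; rewrite le0x.
rewrite Lams_rcons /Lam subr_le0.
move: as_; rewrite mem_rcons inE => /predU1P[->|/IHs->]; first by rewrite lambda_base.
exact: lambda_ge0.
Qed.

(* Layer-cake: peel off the indicator of the support of [f]. *)
Lemma monotone_dot_le f u a (K : R) :
  monotone f -> (forall x, 0 <= f x) -> (forall x, f x <= f a) ->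
  (forall X : {set L}, upset X -> a \in X -> \sum_(x in X) u x <= K) ->
  \sum_x u x * f x <= K * f a.
Proof.
move=> + + + uK; have [n] := ubnP #|[set x | 0 < f x]|.
elim: n f => // n IHn f; rewrite ltnS => supp_n f_mono f_ge0 f_le.
have [fa_gt0|fa_le0] := ltP 0 (f a); last first.
  have f0 x : f x = 0 by apply: le_anti; rewrite f_ge0 (le_trans (f_le x)).
  by rewrite f0 mulr0 big1 // => x _; rewrite f0 mulr0.
set S := [set x | 0 < f x] in supp_n.
have aS : a \in S by rewrite inE.
have S_up : upset S.
  by apply/upsetP=> x y; rewrite !inE => fx /f_mono; apply: lt_le_trans.
have [b bS b_min] : exists2 b, b \in S & forall x, x \in S -> f b <= f x.
  by case: (arg_minP (P := mem S) f aS) => b; exists b.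
(* Subtracting the least positive value on the whole support preserves monotonicity and
   nonnegativity, and drops [b] from the support. *)
pose f' x := f x - f b *+ (x \in S).
have fS x : x \notin S -> f x = 0.
  by rewrite inE -leNgt => fx; apply: le_anti; rewrite fx f_ge0.
have f'a : f' a = f a - f b by rewrite /f' aS.
have IH : \sum_x u x * f' x <= K * f' a.
  apply: IHn => [|x y xy|x|x].
  - apply: leq_trans supp_n; apply: proper_card; apply/properP; split.
      apply/subsetP=> x; rewrite !inE /f'; have [|/fS->] := boolP (x \in S).
        by rewrite inE.
      by rewrite subr0.
    by exists b => //; rewrite inE /f' bS subrr ltxx.
  - rewrite /f'; have [xS|xS] := boolP (x \in S).
      by rewrite (upsetP _ S_up _ _ xS xy) lerB // f_mono.
    rewrite fS // subr0; have [yS|/fS->] := boolP (y \in S); last by rewrite subr0.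
    by rewrite subr_ge0 b_min.
  - rewrite /f'; have [xS|/fS->] := boolP (x \in S); last by rewrite subr0.
    by rewrite subr_ge0 b_min.
  - rewrite f'a /f'; have [xS|/fS->] := boolP (x \in S); first by rewrite lerB.
    by rewrite subr0 subr_ge0.
have -> : \sum_x u x * f x = \sum_x u x * f' x + f b * \sum_(x in S) u x.
  rewrite mulr_sumr [X in _ + X]big_mkcond -big_split; apply: eq_bigr => x _ /=.
  by rewrite /f'; case: ifP => _; rewrite ?mulr1n ?mulr0n; ring.
have := ler_wpM2l (f_ge0 b) (uK S S_up aS); rewrite f'a in IH; lra.
Qed.

(** * Moebius inversion of completely monotone functions *)

Lemma moebius_exists psi : exists g : L -> R,
  forall x, psi x = \sum_(y | (y <= x)%O) g y.
Proof.
pose h x := #|[set y | (y < x)%O]|.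
have h_lt x y : (x < y)%O -> (h x < h y)%N.
  move=> xy; apply: proper_card; apply/properP; split.
    by apply/subsetP=> z; rewrite !inE => /lt_trans; apply.
  by exists x; rewrite inE ?ltxx.
suff [g gP] : exists g : L -> R, forall x, (h x < #|L|.+1)%N ->
    psi x = \sum_(y | (y <= x)%O) g y.
  by exists g => x; apply: gP; rewrite ltnS max_card.
elim: #|L|.+1 => [|n [g gP]]; first by exists (fun=> 0).
(* Stage [n] keeps the values at height below [n] and solves for [g x] at height [n], where the sum
   over [y < x] only involves earlier stages. *)
exists (fun x => if (h x < n)%N then g x else psi x - \sum_(y | (y < x)%O) g y).
move=> x; rewrite ltnS => x_n; rewrite (bigD1 x) //=.
rewrite [X in _ = _ + X](eq_bigl (fun y => (y < x)%O)); last by move=> y; rewrite lt_neqAle andbC.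
rewrite [X in _ = _ + X](eq_bigr g) => [|y yx]; last by rewrite (leq_trans (h_lt _ _ yx) x_n).
case: ifP => [x_lt|_]; last by rewrite subrK.
rewrite gP // (bigD1 x) //=; congr (_ + _).
by apply: eq_bigl => y; rewrite lt_neqAle andbC.
Qed.

(** As [y] lies below the meet of [x] and [a] iff it lies below both, each [nabla a] deletes exactly
    the terms with [y <= a]. *)
Lemma nablas_moebius psi (g : L -> R) (s : seq L) x :
  (forall x, psi x = \sum_(y | (y <= x)%O) g y) ->
  nablas s psi x = \sum_(y | (y <= x)%O && all (fun a => ~~ (y <= a)%O) s) g y.
Proof.
move=> psiE; elim/last_ind: s x => [|s a IHs] x.
  by rewrite /nablas /= psiE; apply: eq_bigl => y; rewrite andbT.
rewrite /nablas foldl_rcons /nabla -/(nablas s psi) !IHs.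
rewrite (bigID (fun y => (y <= a)%O)) /= addrC.
rewrite [X in _ + X - _](eq_bigl 
  (fun y => (y <= x `&` a)%O && all (fun a => ~~ (y <= a)%O) s)).
  rewrite addrK; apply: eq_bigl => y; rewrite all_rcons.
  by rewrite -andbA (andbC (all _ _)).
by move=> y; rewrite lexI; do 3?case: (_ <= _)%O => //=; rewrite ?andbT ?andbF.
Qed.

(** Differencing at [x] along all elements strictly below [x] leaves the single term [g x]. *)
Lemma moebius_ge0 psi (g : L -> R) : completely_monotone psi ->
  (forall x, psi x = \sum_(y | (y <= x)%O) g y) -> forall x, 0 <= g x.
Proof.
move=> psi_cm psiE x.
have := psi_cm (enum [set z | (z < x)%O]) x; rewrite (nablas_moebius _ g) //.
rewrite (big_pred1 x) // => y; apply/andP/eqP => [[yx /allP ys]|->].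
  move: yx; rewrite le_eqVlt => /predU1P[//|yx].
  by have := ys y; rewrite mem_enum inE yx lexx => /(_ isT).
split=> //; apply/allP => z; rewrite mem_enum inE => zx.
by rewrite lt_geF.
Qed.

(** * The greedy decomposition *)

(* Abel summation: [c] stands for the last value of [V] along [s]. *)
Lemma greedy_bound phi (g V u : L -> R) (s : seq L) (c : R) :
  capacity phi ->
  (forall y (X : {set L}), upset X -> y \in X -> \sum_(x in X) u x <= - V y) ->
  pairwise (fun x y => V y <= V x) s ->
  (forall t t', s = t ++ t' -> \sum_(y <- t) g y <= 1 - Lams t phi \top%O) ->
  (forall y, y \in s -> c <= V y) ->
  \sum_x u x * (phi x - Lams s phi x) + \sum_(y <- s) g y * V y
    + c * (1 - Lams s phi \top%O - \sum_(y <- s) g y) <= 0.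
Proof.
case=> phi_mono phi0 phi1 uV.
elim/last_ind: s c => [|s a IHs] c.
  move=> _ _ _; rewrite /Lams /= !big_nil phi1 subrr subr0 mulr0 !addr0.
  by rewrite big1 // => x _; rewrite subrr mulr0.
rewrite pairwise_rcons => /andP[/allP Va V_s] g_le c_le.
have [Phi_mono Phi_ge0] : monotone (Lams s phi) /\ 0 <= Lams s phi \bot%O.
  by apply: Lams_monotone; rewrite // phi0.
(* Since [V] decreases along the list, [V a] is a valid lower bound for the prefix [s]. *)
have {IHs}IH : \sum_x u x * (phi x - Lams s phi x) + \sum_(y <- s) g y * V y
    + V a * (1 - Lams s phi \top%O - \sum_(y <- s) g y) <= 0.
  by apply: IHs => // t t' st; apply: (g_le t (rcons t' a)); rewrite st rcons_cat.
have := g_le (rcons s a) [::]; rewrite cats0 => /(_ erefl).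
have := c_le a; rewrite mem_rcons mem_head => /(_ isT).
rewrite Lams_rcons !big_rcons /=; set Phi := Lams s phi in Phi_mono Phi_ge0 IH *.
have dotf : \sum_x u x * lambda Phi a x <= - V a * lambda Phi a a.
  apply: monotone_dot_le => [|x|x|].
  - exact: monotone_lambda.
  - exact: lambda_ge0.
  - by rewrite [leRHS]lambda_base // lambda_le_base.
  - by move=> X; apply: uV.
have -> : \sum_x u x * (phi x - Lam a Phi x) =
    \sum_x u x * (phi x - Phi x) + \sum_x u x * lambda Phi a x.
  by rewrite -big_split; apply: eq_bigr => x _; rewrite /Lam /=; ring.
move: dotf; rewrite /Lam lambda_base // lambda_top //.
move: IH; move: (\sum_x _) (\sum_x _) (\sum_(y <- s) _) (\sum_(y <- s) _) => S1 S2 G1 G2.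
(* Given [dotf], the left side exceeds that of [IH] by at most [(c - V a) * D], where [D >= 0] is
   the surplus of peeled mass over [g]-mass once [a] is included. *)
nra.
Qed.

(** Ties are broken by the size of the principal ideal, which is strictly increasing in the order;
    for antitone [V], sorting thus yields a linear extension. *)
Definition schedule (V : L -> R) : rel L := fun x y =>
  (V y < V x) || (V x == V y) && (#|[set z | (z <= x)%O]| <= #|[set z | (z <= y)%O]|)%N.

Lemma schedule_total V : total (schedule V).
Proof. by move=> x y; rewrite /schedule; case: ltgtP => //= _; apply: leq_total. Qed.

Lemma schedule_trans V : transitive (schedule V).
Proof.
move=> y x z; rewrite /schedule => /orP[xy|/andP[/eqP-> xy]].
  case/orP=> [yz|/andP[/eqP<- _]]; last by rewrite xy.
  by rewrite (lt_trans yz xy).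
case/orP=> [->//|/andP[-> yz]]; rewrite (leq_trans xy yz) andbT orbT //.
Qed.

Lemma schedule_le V x y : schedule V x y -> V y <= V x.
Proof. by case/orP=> [/ltW|/andP[/eqP->]]. Qed.

Lemma schedule_lt V x y : (forall x y, (x <= y)%O -> V y <= V x) ->
  (x < y)%O -> ~~ schedule V y x.
Proof.
move=> V_anti xy; rewrite /schedule negb_or -leNgt V_anti ?ltW //=.
rewrite negb_and -ltnNge; apply/orP; right.
apply: proper_card; apply/properP; split.
  by apply/subsetP => z; rewrite !inE => /le_trans; apply; apply: ltW.
by exists y; rewrite !inE // lt_geF.
Qed.

Lemma schedule_monotone_path V (s : seq L) :
  (forall x y, (x <= y)%O -> V y <= V x) ->
  s != [::] -> uniq s -> pairwise (schedule V) s -> monotone_path s.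
Proof.
move=> V_anti s0 s_uniq /(pairwiseP \bot%O) sP; split=> // i j i_s j_s ij.
rewrite ltnNge leq_eqVlt; apply/negP => /predU1P[ji|ji].
  by rewrite ji ltxx in ij.
by have := schedule_lt _ _ _ V_anti ij; rewrite sP.
Qed.

(** * The dual inequality required by Farkas' lemma *)

Lemma coupling_dual phi psi (g u v : L -> R) :
  capacity phi -> capacity psi -> completely_monotone psi ->
  (forall x, psi x = \sum_(y | (y <= x)%O) g y) ->
  (forall s : seq L, monotone_path s -> Lams s phi \top%O <= nablas s psi \top%O) ->
  (forall y (X : {set L}), upset X -> y \in X -> \sum_(x in X) u x + v y <= 0) ->
  \sum_x phi x * u x + \sum_y g y * v y <= 0.
Proof.
move=> phi_cap [_ _ psi1] psi_cm psiE phi_psi uv.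
have g_ge0 := moebius_ge0 _ _ psi_cm psiE.
(* The least antitone majorant of [v]; the default [v y] is the term [z = y]. An up-set containing
   [y] contains every [z >= y], so the dual constraints survive the replacement. *)
pose V y := \big[Num.max/v y]_(z | (y <= z)%O) v z.
have V_ge y z : (y <= z)%O -> v z <= V y by move=> yz; apply: le_bigmax_cond.
have V_le y (c : R) : (forall z, (y <= z)%O -> v z <= c) -> V y <= c.
  by move=> v_c; apply/bigmax_leP; split=> //; apply: v_c.
have V_anti x y : (x <= y)%O -> V y <= V x.
  by move=> xy; apply: V_le => z yz; apply/V_ge/(le_trans xy).
have uV y (X : {set L}) : upset X -> y \in X -> \sum_(x in X) u x <= - V y.
  move=> X_up yX; rewrite lerNr; apply: V_le => z yz.
  have := uv z X X_up (upsetP _ X_up _ _ yX yz); lra.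
pose s := sort (schedule V) (enum L).
have s_uniq : uniq s by rewrite sort_uniq enum_uniq.
have s_pw : pairwise (schedule V) s.
  rewrite -sorted_pairwise; last exact: schedule_trans.
  exact/sort_sorted/schedule_total.
have sum_s (F : L -> R) : \sum_(y <- s) F y = \sum_y F y.
  by rewrite -big_enum; apply: perm_big; rewrite perm_sort.
have g1 : \sum_y g y = 1.
  by rewrite -psi1 psiE; apply: eq_bigl => y; rewrite lex1.
have g_le t t' : s = t ++ t' -> \sum_(y <- t) g y <= 1 - Lams t phi \top%O.
  case: phi_cap => _ _ phi1; have [->|t0 st] := eqVneq t [::].
    by rewrite big_nil /Lams /= phi1 subrr.
  have t_uniq : uniq t by move: s_uniq; rewrite st cat_uniq => /andP[].
  have t_pw : pairwise (schedule V) t by move: s_pw; rewrite st pairwise_cat => /and3P[].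
  have := phi_psi _ (schedule_monotone_path _ _ V_anti t0 t_uniq t_pw).
  rewrite (nablas_moebius _ g) // => phi_t.
  (* The difference at the top counts the [y] below no element of [t]; these all lie outside [t]. *)
  have : \sum_(y | (y <= \top)%O && all (fun a => ~~ (y <= a)%O) t) g y
      <= \sum_(y | y \notin t) g y.
    rewrite [leLHS]big_mkcond [leRHS]big_mkcond; apply: ler_sum => y _.
    rewrite lex1 /=; case: ifP => [/allP yt|_]; last by case: ifP.
    by case: ifPn => //; rewrite negbK => /yt; rewrite lexx.
  have := g1; rewrite (bigID (mem t)) /= -big_uniq //; lra.
have Lams_s x : Lams s phi x = 0.
  case: phi_cap => phi_mono phi0 _.
  by apply: Lams_mem; rewrite ?phi0 // mem_sort mem_enum.
have V_top y : y \in s -> V \top%O <= V y by move=> _; apply: V_anti; rewrite lex1.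
have V_pw : pairwise (fun x y => V y <= V x) s.
  by apply: sub_pairwise s_pw; apply: schedule_le.
(* The choice [c = V \top] is harmless: its coefficient vanishes, as all of [phi] is peeled and [g]
   has total mass 1. *)
have := greedy_bound _ _ _ _ _ _ phi_cap uV V_pw g_le V_top.
rewrite Lams_s !sum_s g1 !subr0 subrr mulr0 addr0; apply: le_trans; apply: lerD.
  by apply: ler_sum => x _; rewrite Lams_s subr0 mulrC.
by apply: ler_sum => y _; rewrite ler_wpM2l ?V_ge.
Qed.

End FiniteLattice.

(** * The coupling read off from the Farkas multipliers *)

Theorem theorem4p3 (d : Order.disp_t) (L : finTBLatticeType d) (R : realType)
    (phi psi : L -> R) :
  capacity phi -> capacity psi -> completely_monotone psi ->
  (forall s : seq L, monotone_path s ->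
     (Lams s phi \top%O <= nablas s psi \top%O)%R) ->
  exists (Omega : finType) (P : Omega -> R)
         (X : Omega -> {set L}) (Y : Omega -> L),
    [/\ (forall w, 0 <= P w)%R,
        (\sum_(w : Omega) P w = 1)%R &
        (forall w, nonempty_upset (X w))] /\
    [/\
        (forall x : L, (\sum_(w | x \in X w) P w)%R = phi x),
        (forall x : L, (\sum_(w | (Y w <= x)%O) P w)%R = psi x) &
        (\sum_(w | Y w \in X w) P w)%R = 1%R].
Proof.
move=> phi_cap psi_cap psi_cm phi_psi.
have [g psiE] := moebius_exists _ _ _ psi.
pose adm (w : {set L} * L) := upset _ _ w.1 && (w.2 \in w.1).
(* Coordinate [inl x] tests the event that the up-set contains [x], and [inr y] the event that the
   point is [y]; multipliers on admissible pairs then form a joint law with the marginals [c]. *)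
pose A (w : {set L} * L) (j : L + L) : R :=
  match j with inl x => (x \in w.1)%:R | inr y => (w.2 == y)%:R end.
pose c (j : L + L) : R := match j with inl x => phi x | inr y => g y end.
have [||l [l_ge0 l_c]] := farkas R _ _ (enum adm) A c.
- exact: enum_uniq.
- move=> z Az; rewrite big_sumType /=.
  apply: (coupling_dual _ _ _ phi psi g (z \o inl) (z \o inr)) => // y X X_up yX.
  have uX : \sum_(x in X) z (inl x) = \sum_x (x \in X)%:R * z (inl x).
    by rewrite big_mkcond; apply: eq_bigr => x _; case: ifP; rewrite ?mul1r ?mul0r.
  have vy : z (inr y) = \sum_i (y == i)%:R * z (inr i).
    rewrite (bigD1 y) //= eqxx mul1r big1 ?addr0 // => i.
    by rewrite eq_sym => /negbTE->; rewrite mul0r.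
  have := Az (X, y); rewrite mem_enum unfold_in /adm /= X_up => /(_ yX).
  by rewrite big_sumType /= uX vy.
pose P w := if adm w then l w else 0.
(* [nonempty_upset] is required at every outcome, so inadmissible pairs, which are null under [P],
   are sent to the full set. *)
pose X w := if adm w then w.1 else [set: L].
have PE (Q : pred ({set L} * L)) :
    \sum_(w | Q w) P w = \sum_(w <- enum adm) l w * (Q w)%:R.
  rewrite big_enum big_mkcond [RHS]big_mkcond; apply: eq_bigr => w _.
  by rewrite /P unfold_in -/(adm w); case: (Q w); case: (adm w); rewrite ?mulr1 ?mulr0.
have X_up w : nonempty_upset (X w).
  rewrite /X; case: ifP => [/andP[/upsetP w_up w2]|_]; split=> //.
  - by apply/set0Pn; exists w.2.
  - by apply/set0Pn; exists \top%O.
have PX x : \sum_(w | x \in X w) P w = phi x.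
  rewrite PE -[phi x]/(c (inl x)) l_c; apply: eq_big_seq => w; rewrite mem_enum => w_adm.
  by rewrite /X (w_adm : adm w).
have PY y : \sum_(w | w.2 == y) P w = g y by rewrite PE -[g y]/(c (inr y)) l_c.
have P1 : \sum_w P w = 1.
  (* The top belongs to every [X w], so the total mass is [phi \top]. *)
  case: phi_cap => _ _ <-; rewrite -PX; apply: eq_bigl => w; apply/esym.
  have [/set0Pn[x xX] w_up] := X_up w; exact: w_up xX (lex1 x).
exists ({set L} * L)%type, P, X, snd; split; split=> //.
- by move=> w; rewrite /P; case: ifP.
- move=> x; rewrite psiE (partition_big snd (fun y => (y <= x)%O)) //=.
  apply: eq_bigr => y yx; rewrite -PY; apply: eq_bigl => w.
  by case: eqP => [->|]; rewrite ?yx ?andbF.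
rewrite -P1 big_mkcond; apply: eq_bigr => w _; case: ifPn => //.
by rewrite /P /X; case: ifP => // /andP[_ ->].
Qed.
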